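(* Consider the reduced middle system, on $z>0$, $$z'=\frac y2,\quad y'=\frac{D+\frac12y^2}{z},\quad h'=\frac{\Gamma+\frac12hy}{z},\quad k'=-z^2,\quad D'=0,\quad\Gamma'=0,\quad\xi'=0,$$ where $'=d/ds$. Assume $D<0$ and let $a:=\sqrt{-2D}>0$. For every $\lambda>0$ the system has, up to translation in $s$, a unique trajectory (in its $(z,y,h)$-components) satisfying $$y^2+\lambda^2z^2=a^2,\qquad Dh-\Gamma y=0.$$ This trajectory joins, in its $(z,y,h)$-components, the points $P_{\mathrm{in}}^0=(0,a,\frac\Gamma Da)$ and $P_{\mathrm{out}}^0=(0,-a,-\frac\Gamma Da)$. More precisely, after fixing $s_-\in\mathbb{R}$ and setting $s_+:=s_-+\frac{2\pi}\lambda$, it is given for $s_-\le s\le s_+$ by $$z(s)=\frac a\lambda\sin\Big(\frac\lambda2(s-s_-)\Big),\quad y(s)=a\cos\Big(\frac\lambda2(s-s_-)\Big),\quad h(s)=\frac\Gamma Da\cos\Big(\frac\lambda2(s-s_-)\Big).$$ For every $0<\eta<a/\lambda$ define the transverse sections $\Sigma_{\mathrm{in}}^\eta=\{z=\eta,\ y>0\}$ and $\Sigma_{\mathrm{out}}^\eta=\{z=\eta,\ y<0\}$. If $\theta_\eta:=\arcsin(\lambda\eta/a)\in(0,\frac\pi2)$, then the corresponding entry and exit points have $(z,y,h)$-components $$P_{\mathrm{in}}^\eta=\Big(\eta,\sqrt{a^2-\lambda^2\eta^2},\tfrac\Gamma D\sqrt{a^2-\lambda^2\eta^2}\Big),\qquad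 P_{\mathrm{out}}^\eta=\Big(\eta,-\sqrt{a^2-\lambda^2\eta^2},-\tfrac\Gamma D\sqrt{a^2-\lambda^2\eta^2}\Big).$$ The change in $k$ along the truncated orbit from $P_{\mathrm{in}}^\eta$ to $P_{\mathrm{out}}^\eta$ is $$k_{\mathrm{in}}^\eta-k_{\mathrm{out}}^\eta=\frac{-2D}{\lambda^3}\big(\pi-2\theta_\eta+\sin(2\theta_\eta)\big),$$ and letting $\eta\to0^+$ gives $$k_L-k_R=\frac{-2\pi D}{\lambda^3},$$ where $k_L$ and $k_R$ are the values of $k$ at the initial and final endpoints. Consequently, whenever a prescribed value $k_L-k_R>0$ is given, the unique value of $\lambda$ producing this change in $k$ is $$\lambda_*=\Big(\frac{-2\pi D}{k_L-k_R}\Big)^{1/3},$$ and this matching condition is nondegenerate: $$\frac{d}{d\lambda}\Big(\frac{-2\pi D}{\lambda^3}\Big)\Big|_{\lambda=\lambda_*}=\frac{6\pi D}{\lambda_*^4}\ne0.$$ Finally, the reconstructed variable $W$ satisfies $$W_R-W_L=(k_R-k_L)\begin{pmatrix} 1 \\ c \\ v_\delta \end{pmatrix}.$$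
   Context: $D,\Gamma,\xi$ are constant along trajectories, with $\xi=c$, where $c$ (the singular-shock speed) and $v_\delta$ are fixed real constants. The variable $W=(w_1,w_2,w_3)^T$ is reconstructed from $(k,D,\Gamma,\xi)$ by $w_1=k$, $w_2=\xi k-D$, $w_3=v_\delta k-\Gamma$; $W_L$ and $W_R$ denote its values at the initial ($s=s_-$) and final ($s=s_+$) endpoints of the trajectory. *)

(* Defs.v *)
From Stdlib Require Export Reals.
From Coquelicot Require Export Coquelicot.
Open Scope R_scope.

Record state : Type := State {
  st_z : R; st_y : R; st_h : R; st_k : R;
  st_D : R; st_G : R; st_xi : R }.

Definition zyh (p : state) : R * R * R := (st_z p, st_y p, st_h p).

Definition vfield (p : state) : state :=
  State (st_y p / 2)
        ((st_D p + / 2 * st_y p ^ 2) / st_z p)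
        ((st_G p + / 2 * (st_h p * st_y p)) / st_z p)
        (- st_z p ^ 2)
        0 0 0.

Definition derives (X : R -> state) (s : R) (v : state) : Prop :=
  is_derive (fun t => st_z (X t)) s (st_z v) /\
  is_derive (fun t => st_y (X t)) s (st_y v) /\
  is_derive (fun t => st_h (X t)) s (st_h v) /\
  is_derive (fun t => st_k (X t)) s (st_k v) /\
  is_derive (fun t => st_D (X t)) s (st_D v) /\
  is_derive (fun t => st_G (X t)) s (st_G v) /\
  is_derive (fun t => st_xi (X t)) s (st_xi v).

Definition tends (X : R -> state) (F : (R -> Prop) -> Prop) (p : state) : Prop :=
  filterlim (fun t => st_z (X t)) F (locally (st_z p)) /\
  filterlim (fun t => st_y (X t)) F (locally (st_y p)) /\
  filterlim (fun t => st_h (X t)) F (locally (st_h p)) /\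
  filterlim (fun t => st_k (X t)) F (locally (st_k p)) /\
  filterlim (fun t => st_D (X t)) F (locally (st_D p)) /\
  filterlim (fun t => st_G (X t)) F (locally (st_G p)) /\
  filterlim (fun t => st_xi (X t)) F (locally (st_xi p)).

Definition between (lo hi : Rbar) (s : R) : Prop := Rbar_lt lo s /\ Rbar_lt s hi.

(* The values of [X] outside the interval ]lo, hi[ are irrelevant. *)
Definition solution (lo hi : Rbar) (X : R -> state) : Prop :=
  Rbar_lt lo hi /\
  forall s, between lo hi s -> 0 < st_z (X s) /\ derives X s (vfield (X s)).

(* A trajectory is a solution that is not extendable inside the phase space z > 0. *)
Definition trajectory (lo hi : Rbar) (X : R -> state) : Prop :=
  solution lo hi X /\
  forall lo' hi' X',
    solution lo' hi' X' -> Rbar_le lo' lo -> Rbar_le hi hi' ->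
    (forall s, between lo hi s -> X' s = X s) ->
    lo' = lo /\ hi' = hi.

Definition special_trajectory (D G c lam : R) (lo hi : Rbar) (X : R -> state) : Prop :=
  trajectory lo hi X /\
  forall s, between lo hi s ->
    (st_D (X s) = D /\ st_G (X s) = G /\ st_xi (X s) = c) /\
    st_y (X s) ^ 2 + lam ^ 2 * st_z (X s) ^ 2 = sqrt (-2 * D) ^ 2 /\
    D * st_h (X s) - G * st_y (X s) = 0.

(* The vector field is singular on z = 0, so the endpoints are reached only by
   continuous extension. *)
Definition closed_extension (sm sp : R) (X Xb : R -> state) : Prop :=
  (forall s, sm < s < sp -> Xb s = X s) /\
  tends X (at_right sm) (Xb sm) /\
  tends X (at_left sp) (Xb sp).

Definition Sigma_in (eta : R) (p : state) : Prop := st_z p = eta /\ 0 < st_y p.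
Definition Sigma_out (eta : R) (p : state) : Prop := st_z p = eta /\ st_y p < 0.

(* Transversality of the vector field to a piece [S] of a level set of z. *)
Definition transverse_z (S : state -> Prop) : Prop :=
  forall p, S p -> st_z (vfield p) <> 0.

Definition W (vdelta : R) (p : state) : R * R * R :=
  (st_k p, st_xi p * st_k p - st_D p, vdelta * st_k p - st_G p).

(* Main.v *)
Require Import Defs.
From Stdlib Require Import Lra.

(** On the ellipse [y ^ 2 + lam ^ 2 * z ^ 2 = a ^ 2 = -2 * D] the numerator
    [D + y ^ 2 / 2] equals [- lam ^ 2 * z ^ 2 / 2], so the singular factor [1 / z]
    cancels and [(z, y)] obeys the harmonic oscillator [z' = y / 2],
    [y' = - lam ^ 2 * z / 2].  In terms of the phase [x = lam / 2 * (s - sm)] the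
    orbit is the half-ellipse [z = a / lam * sin x], [y = a * cos x] over
    [0 < x < PI]; the second constraint makes [h] the multiple [G / D] of [y], and
    [k] is obtained by integrating [- z ^ 2].

    Every special trajectory is such an orbit ([special_trajectory_classification]).
    At one point of its interval, [upper_half_circle] chooses [sm] so that the orbit
    and the explicit solution agree there; conservation of the energy of their
    difference ([oscillator_rigidity]) makes them agree throughout.  Positivity of
    [z] confines the interval to [0 < x < PI], and maximality makes it all of that
    range.  Conversely the half-ellipse is maximal, since an extension would be
    continuous with [z > 0] at an end where [z] tends to [0]
    ([half_ellipse_not_extendable]).

    Everything else is read off from the explicit orbit.  It meets [z = eta] at
    the phases [theta] and [PI - theta], where [a / lam * sin theta = eta]; the
    closed form of [k] gives the drop between them, and [theta -> 0] as
    [eta -> 0] gives the total drop [-2 * PI * D / lam ^ 3].  Matching a prescribed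
    drop amounts to injectivity of the cube on positive numbers. *)

(** * Two facts of one-variable calculus *)

Lemma between_connected (lo hi : Rbar) (s t u : R) :
  between lo hi s -> between lo hi t -> s <= u <= t -> between lo hi u.
Proof.
  intros [H1 _] [_ H2] Hu; split.
  - apply Rbar_lt_le_trans with (1 := H1); simpl; lra.
  - apply Rbar_le_lt_trans with (2 := H2); simpl; lra.
Qed.

Lemma between_nonempty (lo hi : Rbar) : Rbar_lt lo hi -> exists s, between lo hi s.
Proof.
  unfold between; destruct lo as [l| |], hi as [r| |]; simpl; intro H; try easy.
  - exists ((l + r) / 2); lra.
  - exists (l + 1); split; [lra | easy].
  - exists (r - 1); split; [easy | lra].
  - exists 0; easy.
Qed.

(** Stated for endpoints in [Rbar] because a trajectory is not known to have a
    bounded interval of definition before it is classified. *)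
Lemma null_derive_constant (lo hi : Rbar) (f : R -> R) (s t : R) :
  (forall u, between lo hi u -> is_derive f u 0) ->
  between lo hi s -> between lo hi t -> f s = f t.
Proof.
  intros Hf Hs Ht.
  assert (Hle : forall x y, between lo hi x -> between lo hi y -> x <= y -> f x = f y).
  { intros x y Hx Hy Hxy.
    destruct (MVT_gen f x y (fun _ => 0)) as [w [_ Hw]].
    - intros u Hu; rewrite Rmin_left, Rmax_right in Hu by easy.
      apply Hf, (between_connected _ _ x y); easy || lra.
    - intros u Hu; rewrite Rmin_left, Rmax_right in Hu by easy.
      apply continuity_pt_filterlim, (ex_derive_continuous f).
      exists 0; apply Hf, (between_connected _ _ x y); easy || lra.
    - lra. }
  destruct (Rle_dec s t); [|symmetry]; apply Hle; easy || lra.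
Qed.

(** * The explicit orbit *)

Definition phase (lam sm s : R) : R := lam / 2 * (s - sm).

(** The [k]-component is the primitive of [- z ^ 2] with value [K] at [sm]:
    the derivative of [x - sin x * cos x] is [2 * sin x ^ 2], and [a ^ 2 = -2 * D]
    turns the coefficient into [2 * D / lam ^ 3]. *)
Definition half_ellipse (D G c lam sm K s : R) : state :=
  let a := sqrt (-2 * D) in
  let x := phase lam sm s in
  State (a / lam * sin x) (a * cos x) (G / D * a * cos x)
        (K + 2 * D / lam ^ 3 * (x - sin x * cos x)) D G c.

Lemma state_eq (p q : state) :
  st_z p = st_z q -> st_y p = st_y q -> st_h p = st_h q -> st_k p = st_k q ->
  st_D p = st_D q -> st_G p = st_G q -> st_xi p = st_xi q -> p = q.
Proof. destruct p, q; simpl; intros; subst; easy. Qed.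

Lemma amplitude_pos (D : R) : D < 0 -> 0 < sqrt (-2 * D).
Proof. intro HD; apply sqrt_lt_R0; lra. Qed.

Lemma amplitude_sqr (D : R) : D < 0 -> sqrt (-2 * D) ^ 2 = -2 * D.
Proof. intro HD; apply pow2_sqrt; lra. Qed.

Lemma sin_cos_sqr (x : R) : sin x ^ 2 + cos x ^ 2 = 1.
Proof. rewrite <- !Rsqr_pow2; apply sin2_cos2. Qed.

Lemma phase_range (lam sm s : R) :
  0 < lam -> sm < s < sm + 2 * PI / lam <-> 0 < phase lam sm s < PI.
Proof.
  intro Hl; unfold phase.
  assert (E : PI = lam / 2 * (2 * PI / lam)) by (field; lra).
  rewrite E at 2.
  split; intros [H1 H2]; split.
  - apply Rmult_lt_0_compat; lra.
  - apply Rmult_lt_compat_l; lra.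
  - apply (Rmult_lt_reg_l (lam / 2)); lra.
  - apply Rmult_lt_reg_l in H2; lra.
Qed.

Lemma phase_end (lam sm : R) : 0 < lam -> phase lam sm (sm + 2 * PI / lam) = PI.
Proof. intro Hl; unfold phase; field; lra. Qed.

Lemma phase_start (lam sm : R) : phase lam sm sm = 0.
Proof. unfold phase; ring. Qed.

Lemma phase_range_closed (lam sm s : R) :
  0 < lam -> sm <= s <= sm + 2 * PI / lam -> 0 <= phase lam sm s <= PI.
Proof.
  intros Hl [H1 H2].
  rewrite <- (phase_start lam sm) at 1; rewrite <- (phase_end lam sm Hl).
  split; apply Rmult_le_compat_l; lra.
Qed.

Lemma half_ellipse_constraints (D G c lam sm K s : R) :
  D < 0 -> 0 < lam ->
  let p := half_ellipse D G c lam sm K s in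
  st_y p ^ 2 + lam ^ 2 * st_z p ^ 2 = sqrt (-2 * D) ^ 2 /\
  D * st_h p - G * st_y p = 0.
Proof.
  intros HD Hl; simpl; split; [|field; lra].
  generalize (sin_cos_sqr (phase lam sm s)).
  set (a := sqrt _); set (x := sin _); set (y := cos _); intro E.
  transitivity (a ^ 2 * (x ^ 2 + y ^ 2)); [field; lra | rewrite E; ring].
Qed.

(** Since [h = G / D * y], the singular quotient defining [h'] is [G / D] times
    the one defining [y'], so a single cancellation of [1 / z] serves both. *)
Lemma half_ellipse_derives (D G c lam sm K s : R) :
  D < 0 -> 0 < lam -> 0 < sin (phase lam sm s) ->
  derives (half_ellipse D G c lam sm K) s (vfield (half_ellipse D G c lam sm K s)).
Proof.
  intros HD Hl Hs.
  pose proof (amplitude_pos D HD) as Ha; pose proof (amplitude_sqr D HD) as Ea.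
  pose proof (sin_cos_sqr (phase lam sm s)) as Ex.
  unfold derives, half_ellipse, vfield;
    cbn [st_z st_y st_h st_k st_D st_G st_xi].
  revert Ha Ea Ex Hs; unfold phase; generalize (sqrt (-2 * D)).
  intros a Ha Ea Ex Hs.
  (* The constraint turns the numerator of [y'] into a multiple of [z]. *)
  assert (Ey : (D + / 2 * (a * cos (lam / 2 * (s - sm))) ^ 2)
               = - lam / 2 * a * sin (lam / 2 * (s - sm))
                 * (a / lam * sin (lam / 2 * (s - sm)))).
  { rewrite Rpow_mult_distr.
    replace (cos _ ^ 2) with (1 - sin (lam / 2 * (s - sm)) ^ 2) by lra.
    replace D with (- a ^ 2 / 2) by lra.
    field; lra. }
  assert (Hz : a / lam * sin (lam / 2 * (s - sm)) <> 0).
  { apply Rgt_not_eq, Rmult_lt_0_compat; [apply Rdiv_lt_0_compat|]; lra. }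
  refine (conj _ (conj _ (conj _ (conj _ (conj _ (conj _ _))))));
    try apply @is_derive_const.
  - auto_derive; [easy | unfold Rminus; field; lra].
  - rewrite Ey; auto_derive; [easy | fold (s - sm); field; lra].
  - replace (G + _) with
      (G / D * (D + / 2 * (a * cos (lam / 2 * (s - sm))) ^ 2)) by (field; lra).
    rewrite Ey; auto_derive; [easy | fold (s - sm); field; lra].
  - auto_derive; [easy | fold (s - sm)].
    replace (- (a / lam * sin (lam / 2 * (s - sm))) ^ 2)
      with (- a ^ 2 / lam ^ 2 * sin (lam / 2 * (s - sm)) ^ 2) by (field; lra).
    rewrite Ea.
    transitivity (D / lam ^ 2 * (1 - cos (lam / 2 * (s - sm)) ^ 2
                                 + sin (lam / 2 * (s - sm)) ^ 2)).
    + field; lra.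
    + replace (cos _ ^ 2) with (1 - sin (lam / 2 * (s - sm)) ^ 2) by lra.
      field; lra.
Qed.

Lemma half_ellipse_continuous (D G c lam sm K s : R)
  (F : (R -> Prop) -> Prop) {FF : Filter F} :
  filter_le F (locally s) ->
  tends (half_ellipse D G c lam sm K) F (half_ellipse D G c lam sm K s).
Proof.
  intro HF.
  assert (Hc : forall f : R -> R, ex_derive f s -> filterlim f F (locally (f s))).
  { intros f Hf; apply filterlim_filter_le_1 with (1 := HF).
    apply (ex_derive_continuous f), Hf. }
  unfold tends, half_ellipse, phase; cbn [st_z st_y st_h st_k st_D st_G st_xi].
  repeat split; apply Hc; auto_derive; easy.
Qed.

Lemma half_period_pos (sm lam : R) : 0 < lam -> sm < sm + 2 * PI / lam.
Proof.
  intro Hl; assert (0 < 2 * PI / lam); [|lra].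
  apply Rdiv_lt_0_compat; generalize PI_RGT_0; lra.
Qed.

Lemma half_ellipse_solution (D G c lam sm K : R) :
  D < 0 -> 0 < lam ->
  solution sm (sm + 2 * PI / lam) (half_ellipse D G c lam sm K).
Proof.
  intros HD Hl; split.
  - apply half_period_pos, Hl.
  - intros s Hs.
    assert (Hsin : 0 < sin (phase lam sm s))
      by (apply phase_range in Hs; [apply sin_gt_0; apply Hs | easy]).
    split.
    + apply Rmult_lt_0_compat; [|easy].
      apply Rdiv_lt_0_compat; [apply amplitude_pos|]; easy.
    + apply half_ellipse_derives; easy.
Qed.

Lemma half_ellipse_zyh_start (D G c lam sm K : R) :
  zyh (half_ellipse D G c lam sm K sm)
  = (0, sqrt (-2 * D), G / D * sqrt (-2 * D)).
Proof.
  unfold zyh, half_ellipse; simpl.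
  rewrite phase_start, sin_0, cos_0, !Rmult_1_r, Rmult_0_r; easy.
Qed.

Lemma half_ellipse_zyh_end (D G c lam sm K : R) :
  0 < lam ->
  zyh (half_ellipse D G c lam sm K (sm + 2 * PI / lam))
  = (0, - sqrt (-2 * D), - (G / D) * sqrt (-2 * D)).
Proof.
  intro Hl; unfold zyh, half_ellipse; simpl.
  rewrite phase_end, sin_PI, cos_PI by easy; f_equal; [f_equal|]; ring.
Qed.

Lemma half_ellipse_k_drop (D G c lam sm K : R) :
  0 < lam ->
  st_k (half_ellipse D G c lam sm K sm)
  - st_k (half_ellipse D G c lam sm K (sm + 2 * PI / lam)) = -2 * PI * D / lam ^ 3.
Proof.
  intro Hl; unfold half_ellipse; cbn [st_k].
  rewrite phase_start, phase_end, sin_0, sin_PI by easy; field; lra.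
Qed.

(** * Maximality *)

Lemma solution_z_continuous (lo hi : Rbar) (X : R -> state) (s : R) :
  solution lo hi X -> between lo hi s ->
  filterlim (fun t => st_z (X t)) (locally s) (locally (st_z (X s))).
Proof.
  intros [_ HX] Hs; apply HX in Hs; destruct Hs as [_ [Hz _]].
  apply (ex_derive_continuous (fun t => st_z (X t))); eexists; exact Hz.
Qed.

(** Solutions live in [z > 0] by definition, so a point at which
    [z] tends to [0] cannot be interior to the interval of definition. *)
Lemma solution_z_vanishes (lo hi : Rbar) (X : R -> state) (s : R)
  (F : (R -> Prop) -> Prop) {FF : ProperFilter F} :
  solution lo hi X -> filter_le F (locally s) ->
  filterlim (fun t => st_z (X t)) F (locally 0) -> ~ between lo hi s.
Proof.
  intros HX HF H0 Hs.
  assert (E : st_z (X s) = 0).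
  { apply (filterlim_locally_unique (F := F) (fun t => st_z (X t))); [|easy].
    apply filterlim_filter_le_1 with (1 := HF).
    apply (solution_z_continuous lo hi); easy. }
  destruct HX as [_ HX]; apply HX in Hs; lra.
Qed.

Lemma filter_le_at_right (s : R) : filter_le (at_right s) (locally s).
Proof. intros P HP; apply filter_le_within; easy. Qed.

Lemma filter_le_at_left (s : R) : filter_le (at_left s) (locally s).
Proof. intros P HP; apply filter_le_within; easy. Qed.

Lemma at_right_interval (a b : R) : a < b -> at_right a (fun s => a < s < b).
Proof.
  intro H; assert (He : 0 < b - a) by lra.
  exists (mkposreal _ He); intros s Hs Has.
  apply Rabs_lt_between' in Hs; simpl in Hs; lra.
Qed.

Lemma at_left_interval (a b : R) : a < b -> at_left b (fun s => a < s < b).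
Proof.
  intro H; assert (He : 0 < b - a) by lra.
  exists (mkposreal _ He); intros s Hs Has.
  apply Rabs_lt_between' in Hs; simpl in Hs; lra.
Qed.

Lemma tends_ext (X Y : R -> state) (F : (R -> Prop) -> Prop) {FF : Filter F} (p : state) :
  F (fun s => X s = Y s) -> tends X F p -> tends Y F p.
Proof.
  intros H (H1 & H2 & H3 & H4 & H5 & H6 & H7).
  refine (conj _ (conj _ (conj _ (conj _ (conj _ (conj _ _)))))).
  all: eapply filterlim_ext_loc; [|eassumption].
  all: apply filter_imp with (2 := H); intros s E; rewrite E; easy.
Qed.

Lemma half_ellipse_tends_start (D G c lam sm K : R) (X : R -> state) :
  0 < lam ->
  (forall s, sm < s < sm + 2 * PI / lam -> X s = half_ellipse D G c lam sm K s) ->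
  tends X (at_right sm) (half_ellipse D G c lam sm K sm).
Proof.
  intros Hl HX; apply (tends_ext (half_ellipse D G c lam sm K)); [apply _ | |].
  - refine (filter_imp _ _ _ (at_right_interval _ _ (half_period_pos sm lam Hl))).
    intros s Hs; symmetry; apply HX; easy.
  - apply half_ellipse_continuous, filter_le_at_right; apply _.
Qed.

Lemma half_ellipse_tends_end (D G c lam sm K : R) (X : R -> state) :
  0 < lam ->
  (forall s, sm < s < sm + 2 * PI / lam -> X s = half_ellipse D G c lam sm K s) ->
  tends X (at_left (sm + 2 * PI / lam))
    (half_ellipse D G c lam sm K (sm + 2 * PI / lam)).
Proof.
  intros Hl HX; apply (tends_ext (half_ellipse D G c lam sm K)); [apply _ | |].
  - refine (filter_imp _ _ _ (at_left_interval _ _ (half_period_pos sm lam Hl))).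
    intros s Hs; symmetry; apply HX; easy.
  - apply half_ellipse_continuous, filter_le_at_left; apply _.
Qed.

(** [z] tends to [0] at both ends of the half-ellipse, so neither end can be an
    interior point of a larger interval of definition. *)
Lemma half_ellipse_not_extendable (D G c lam sm K : R) (X : R -> state) (lo hi : Rbar) :
  0 < lam ->
  (forall s, sm < s < sm + 2 * PI / lam -> X s = half_ellipse D G c lam sm K s) ->
  solution lo hi X -> Rbar_le lo sm -> Rbar_le (sm + 2 * PI / lam) hi ->
  lo = sm /\ hi = sm + 2 * PI / lam.
Proof.
  intros Hl HX Hsol Hlo Hhi; pose proof (half_period_pos sm lam Hl) as Hlt.
  destruct (half_ellipse_tends_start D G c lam sm K X Hl HX) as [Hm _].
  destruct (half_ellipse_tends_end D G c lam sm K X Hl HX) as [Hp _].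
  injection (half_ellipse_zyh_start D G c lam sm K) as E0 _ _.
  injection (half_ellipse_zyh_end D G c lam sm K Hl) as E1 _ _.
  cbn [st_z half_ellipse] in Hm, Hp; rewrite E0 in Hm; rewrite E1 in Hp.
  apply (solution_z_vanishes lo hi X sm (at_right sm) Hsol (filter_le_at_right sm)) in Hm.
  apply (solution_z_vanishes lo hi X _ (at_left _) Hsol (filter_le_at_left _)) in Hp.
  destruct (Rbar_le_lt_or_eq_dec _ _ Hlo) as [H1|H1],
    (Rbar_le_lt_or_eq_dec _ _ Hhi) as [H2|H2].
  - destruct Hm; split; [easy | apply Rbar_lt_trans with (2 := H2); easy].
  - destruct Hm; rewrite <- H2; easy.
  - destruct Hp; rewrite H1; easy.
  - easy.
Qed.

Lemma half_ellipse_special (D G c lam sm K : R) :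
  D < 0 -> 0 < lam ->
  special_trajectory D G c lam sm (sm + 2 * PI / lam) (half_ellipse D G c lam sm K).
Proof.
  intros HD Hl; split; [split|].
  - apply half_ellipse_solution; easy.
  - intros lo hi X HX Hlo Hhi E.
    apply (half_ellipse_not_extendable D G c lam sm K X); easy.
  - intros s _; split; [easy | apply half_ellipse_constraints; easy].
Qed.

(** * Rigidity *)

(** Supplies the phase of a point of the orbit; [z > 0] selects the upper half
    circle, on which the cosine alone determines the angle. *)
Lemma upper_half_circle (u v : R) :
  0 < u -> u ^ 2 + v ^ 2 = 1 -> exists x, 0 < x < PI /\ sin x = u /\ cos x = v.
Proof.
  intros Hu E.
  assert (Hv : -1 < v < 1) by nra.
  exists (acos v); split; [apply acos_bound_lt; easy | split].
  - rewrite sin_acos by lra.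
    replace (1 - Rsqr v) with (u ^ 2) by (unfold Rsqr; lra).
    apply sqrt_pow2; lra.
  - apply cos_acos; lra.
Qed.

(** The difference [(p, q)] from the explicit solution obeys the same linear
    system, whose energy [q ^ 2 + lam ^ 2 * p ^ 2] is conserved; it vanishes at
    [t], hence everywhere. *)
Lemma oscillator_rigidity (lo hi : Rbar) (lam a sm t : R) (z y : R -> R) :
  0 < lam -> between lo hi t ->
  (forall s, between lo hi s ->
     is_derive z s (y s / 2) /\ is_derive y s (- lam ^ 2 / 2 * z s)) ->
  z t = a / lam * sin (phase lam sm t) -> y t = a * cos (phase lam sm t) ->
  forall s, between lo hi s ->
    z s = a / lam * sin (phase lam sm s) /\ y s = a * cos (phase lam sm s).
Proof.
  intros Hl Ht Hlin Ez Ey s Hs.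
  pose (p := fun s => z s - a / lam * sin (phase lam sm s)).
  pose (q := fun s => y s - a * cos (phase lam sm s)).
  assert (Hpq : q s ^ 2 + lam ^ 2 * p s ^ 2 = 0).
  { rewrite (null_derive_constant lo hi
      (fun u => q u ^ 2 + lam ^ 2 * p u ^ 2) s t); try easy.
    - unfold p, q; rewrite Ez, Ey; ring.
    - intros u Hu; destruct (Hlin u Hu) as [Hz Hy].
      unfold p, q, phase; auto_derive.
      + repeat split; eexists; eassumption.
      + replace (Derive (fun x => z x) u) with (y u / 2)
          by (symmetry; apply is_derive_unique, Hz).
        replace (Derive (fun x => y x) u) with (- lam ^ 2 / 2 * z u)
          by (symmetry; apply is_derive_unique, Hy).
        fold (u - sm); field; lra. }
  assert (Hp2 : 0 <= lam ^ 2 * p s ^ 2)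
    by (apply Rmult_le_pos; apply pow2_ge_0).
  assert (Hq2 : 0 <= q s ^ 2) by apply pow2_ge_0.
  assert (Hq0 : q s = 0) by nra.
  assert (Hp0 : p s = 0).
  { apply Rsqr_0_uniq; rewrite Rsqr_pow2.
    apply (Rmult_eq_reg_l (lam ^ 2)); [lra | apply pow_nonzero; lra]. }
  unfold p in Hp0; unfold q in Hq0; lra.
Qed.

(** [sm] is read off from the phase of the orbit at the sample time [t] and [K]
    from the value of [k] there; the constraints then leave only [k] to be
    integrated once [(z, y)] is known. *)
Lemma special_is_half_ellipse (D G c lam : R) (lo hi : Rbar) (X : R -> state) (t : R) :
  D < 0 -> 0 < lam -> special_trajectory D G c lam lo hi X -> between lo hi t ->
  exists sm K : R, sm < t < sm + 2 * PI / lam /\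
    forall s, between lo hi s -> X s = half_ellipse D G c lam sm K s.
Proof.
  intros HD Hl [[[_ HX] _] HS] Ht.
  pose proof (amplitude_pos D HD) as Ha; pose proof (amplitude_sqr D HD) as Ea.
  set (a := sqrt (-2 * D)) in *.
  destruct (upper_half_circle (lam * st_z (X t) / a) (st_y (X t) / a))
    as (x & Hx & Hsin & Hcos).
  { apply Rdiv_lt_0_compat; [apply Rmult_lt_0_compat; [easy | apply HX, Ht] | easy]. }
  { destruct (HS t Ht) as (_ & E & _).
    fold a in E. transitivity (a ^ 2 / a ^ 2); [rewrite <- E at 1|]; field; lra. }
  pose (sm := t - 2 * x / lam).
  assert (Ext : phase lam sm t = x) by (unfold phase, sm; field; lra).
  (* On the ellipse the first two equations become the harmonic oscillator
     [z' = y / 2], [y' = - lam ^ 2 * z / 2]. *)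
  assert (Hlin : forall s, between lo hi s ->
    is_derive (fun u => st_z (X u)) s (st_y (X s) / 2) /\
    is_derive (fun u => st_y (X u)) s (- lam ^ 2 / 2 * st_z (X s))).
  { intros s Hs; destruct (HX s Hs) as (Hz & Hdz & Hdy & _).
    destruct (HS s Hs) as ((ED & _) & E & _).
    split; [exact Hdz|].
    replace (- lam ^ 2 / 2 * st_z (X s)) with (st_y (vfield (X s))); [exact Hdy|].
    cbn [vfield st_y]; rewrite ED; fold a in E; rewrite Ea in E.
    replace (st_y (X s) ^ 2) with (-2 * D - lam ^ 2 * st_z (X s) ^ 2) by lra.
    field; lra. }
  assert (Hzy : forall s, between lo hi s ->
    st_z (X s) = a / lam * sin (phase lam sm s) /\ st_y (X s) = a * cos (phase lam sm s)).
  { intros s Hs.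
    apply (oscillator_rigidity lo hi lam a sm t (fun u => st_z (X u)) (fun u => st_y (X u)));
      try easy; rewrite Ext.
    - rewrite Hsin; field; lra.
    - rewrite Hcos; field; lra. }
  pose (k0 := fun s => 2 * D / lam ^ 3
                * (phase lam sm s - sin (phase lam sm s) * cos (phase lam sm s))).
  exists sm, (st_k (X t) - k0 t); split.
  { apply phase_range; [easy | rewrite Ext; easy]. }
  intros s Hs; destruct (Hzy s Hs) as [Hz Hy].
  destruct (HS s Hs) as ((ED & EG & Ec) & _ & Eh).
  apply state_eq; cbn [half_ellipse st_z st_y st_h st_k st_D st_G st_xi]; try easy.
  - apply (Rmult_eq_reg_l D); [|lra].
    transitivity (G * st_y (X s)); [lra | rewrite Hy; fold a; field; lra].
  - assert (E : st_k (X s) - k0 s = st_k (X t) - k0 t); [|fold (k0 s); lra].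
    apply (null_derive_constant lo hi (fun u => st_k (X u) - k0 u)); try easy.
    intros u Hu; destruct (HX u Hu) as (Hpos & _ & _ & _ & Hdk & _).
    destruct (Hzy u Hu) as [Hzu _].
    assert (Hsu : 0 < sin (phase lam sm u)).
    { apply (Rmult_lt_reg_l (a / lam)); [apply Rdiv_lt_0_compat; easy | lra]. }
    destruct (half_ellipse_derives D G c lam sm 0 u HD Hl Hsu)
      as (_ & _ & _ & Hdk0 & _).
    evar_last.
    + apply (is_derive_ext (fun v => minus (st_k (X v))
               (st_k (half_ellipse D G c lam sm 0 v)))).
      * intro v; unfold minus, plus, opp, k0; simpl; ring.
      * apply (is_derive_minus (V := R_NormedModule)); [exact Hdk | exact Hdk0].
    + unfold minus, plus, opp; cbn [vfield half_ellipse st_k st_z]; simpl.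
      rewrite Hzu; fold a; ring.
Qed.

(** The interval of definition cannot contain [sm] or the other end of the half
    period, because the explicit [z] vanishes there; so it lies between them,
    and the half-ellipse itself is an extension, which by maximality is not
    proper. *)
Lemma special_trajectory_classification
  (D G c lam : R) (lo hi : Rbar) (X : R -> state) :
  D < 0 -> 0 < lam -> special_trajectory D G c lam lo hi X ->
  exists sm K : R, lo = sm /\ hi = sm + 2 * PI / lam /\
    forall s, sm < s < sm + 2 * PI / lam -> X s = half_ellipse D G c lam sm K s.
Proof.
  intros HD Hl HX.
  pose proof HX as [[[Hlt Hsol] Hmax] _].
  destruct (between_nonempty lo hi Hlt) as [t Ht].
  destruct (special_is_half_ellipse D G c lam lo hi X t HD Hl HX Ht)
    as (sm & K & Hts & E).
  set (sp := sm + 2 * PI / lam) in *.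
  assert (Hz : forall s, between lo hi s -> sin (phase lam sm s) <> 0).
  { intros s Hs H0; destruct (Hsol s Hs) as [Hz _].
    rewrite (E s Hs) in Hz; cbn [half_ellipse st_z] in Hz.
    rewrite H0 in Hz; lra. }
  assert (Hlo : Rbar_le sm lo).
  { apply Rbar_not_lt_le; intro H; apply (Hz sm).
    - split; [easy|]; apply Rbar_lt_trans with (2 := proj2 Ht); simpl; lra.
    - rewrite phase_start; apply sin_0. }
  assert (Hhi : Rbar_le hi sp).
  { apply Rbar_not_lt_le; intro H; apply (Hz sp).
    - split; [|easy]; apply Rbar_lt_trans with (1 := proj1 Ht); simpl; lra.
    - unfold sp; rewrite phase_end by easy; apply sin_PI. }
  destruct (Hmax sm sp (half_ellipse D G c lam sm K)) as [E1 E2]; try easy.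
  - apply half_ellipse_solution; easy.
  - intros s Hs; symmetry; apply E, Hs.
  - exists sm, K; subst lo hi; split; [easy | split; [easy |]].
    intros s Hs; apply E; easy.
Qed.

(** * The sections [z = eta] *)

Definition time_at (lam sm x : R) : R := sm + 2 * x / lam.

Lemma phase_time_at (lam sm x : R) : 0 < lam -> phase lam sm (time_at lam sm x) = x.
Proof. intro Hl; unfold phase, time_at; field; lra. Qed.

Lemma phase_inv (lam sm s x : R) : 0 < lam -> phase lam sm s = x -> s = time_at lam sm x.
Proof. intros Hl E; subst x; unfold phase, time_at; field; lra. Qed.

Lemma time_at_lt (lam sm x x' : R) : 0 < lam -> x < x' -> time_at lam sm x < time_at lam sm x'.
Proof.
  intros Hl H; apply Rplus_lt_compat_l, Rmult_lt_compat_r; [|lra].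
  apply Rinv_0_lt_compat, Hl.
Qed.

Lemma time_at_0 (lam sm : R) : time_at lam sm 0 = sm.
Proof. unfold time_at, Rdiv; ring. Qed.

(** The last two equations say that [theta] is the phase of the point of the
    orbit with [z = eta] and [y > 0]. *)
Lemma section_angle (a lam eta : R) :
  0 < a -> 0 < lam -> 0 < eta < a / lam ->
  let theta := asin (lam * eta / a) in
  0 < theta < PI / 2 /\ a / lam * sin theta = eta /\
  a * cos theta = sqrt (a ^ 2 - lam ^ 2 * eta ^ 2).
Proof.
  intros Ha Hl [He1 He2] theta.
  assert (Hx0 : 0 < lam * eta / a)
    by (apply Rdiv_lt_0_compat; [apply Rmult_lt_0_compat|]; easy).
  assert (Hx1 : lam * eta / a < 1).
  { apply Rlt_div_l; [easy|].
    apply (Rmult_lt_compat_l lam) in He2; [|easy].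
    replace (lam * (a / lam)) with a in He2 by (field; lra); lra. }
  assert (Es : sin theta = lam * eta / a) by (apply sin_asin; lra).
  assert (Ht : - (PI / 2) < theta < PI / 2) by (apply asin_bound_lt; lra).
  pose proof PI_RGT_0 as HPI.
  split; [|split].
  - split; [|apply Ht].
    apply Rnot_le_lt; intro H.
    assert (0 <= sin (- theta)) by (apply sin_ge_0; lra).
    rewrite sin_neg in *; lra.
  - rewrite Es; field; lra.
  - assert (Hc : 0 < cos theta) by (apply cos_gt_0; lra).
    symmetry; rewrite <- (sqrt_pow2 (a * cos theta)).
    + f_equal; rewrite Rpow_mult_distr.
      replace (cos theta ^ 2) with (1 - sin theta ^ 2)
        by (generalize (sin_cos_sqr theta); lra).
      rewrite Es; field; lra.
    + apply Rlt_le, Rmult_lt_0_compat; easy.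
Qed.

Lemma first_quadrant_sin_inj (x theta : R) :
  0 <= x <= PI -> 0 < theta < PI / 2 -> 0 < cos x -> sin x = sin theta -> x = theta.
Proof.
  intros Hx Ht Hc E.
  assert (x < PI / 2).
  { apply Rnot_le_lt; intro H.
    assert (cos x <= 0) by (apply cos_le_0; lra); lra. }
  apply sin_inj; lra.
Qed.

Lemma Sigma_in_half_ellipse (D G c lam sm K theta s : R) :
  D < 0 -> 0 < lam -> 0 < theta < PI / 2 -> sm <= s <= sm + 2 * PI / lam ->
  Sigma_in (sqrt (-2 * D) / lam * sin theta) (half_ellipse D G c lam sm K s)
  <-> s = time_at lam sm theta.
Proof.
  intros HD Hl Ht Hs.
  pose proof (amplitude_pos D HD) as Ha.
  assert (Hal : 0 < sqrt (-2 * D) / lam) by (apply Rdiv_lt_0_compat; easy).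
  unfold Sigma_in; cbn [half_ellipse st_z st_y]; split.
  - intros [Ez Hy].
    apply phase_inv, first_quadrant_sin_inj; try easy.
    + apply phase_range_closed; easy.
    + apply (Rmult_lt_reg_l (sqrt (-2 * D))); lra.
    + apply Rmult_eq_reg_l in Ez; lra.
  - intro E; subst s; rewrite phase_time_at by easy; split; [easy|].
    apply Rmult_lt_0_compat; [easy | apply cos_gt_0; lra].
Qed.

(** The reflection [x -> PI - x] of the phase preserves [z] and changes the sign
    of [y], which reduces the exit point to the entry point. *)
Lemma Sigma_out_half_ellipse (D G c lam sm K theta s : R) :
  D < 0 -> 0 < lam -> 0 < theta < PI / 2 -> sm <= s <= sm + 2 * PI / lam ->
  Sigma_out (sqrt (-2 * D) / lam * sin theta) (half_ellipse D G c lam sm K s)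
  <-> s = time_at lam sm (PI - theta).
Proof.
  intros HD Hl Ht Hs.
  pose proof (amplitude_pos D HD) as Ha.
  assert (Hal : 0 < sqrt (-2 * D) / lam) by (apply Rdiv_lt_0_compat; easy).
  unfold Sigma_out; cbn [half_ellipse st_z st_y]; split.
  - intros [Ez Hy].
    pose proof (phase_range_closed lam sm s Hl Hs) as Hx.
    apply phase_inv; [easy|].
    enough (PI - phase lam sm s = theta) by lra.
    apply first_quadrant_sin_inj; try easy.
    + lra.
    + rewrite Rtrigo_facts.cos_pi_minus.
      apply (Rmult_lt_reg_l (sqrt (-2 * D))); lra.
    + rewrite sin_PI_x; apply Rmult_eq_reg_l in Ez; lra.
  - intro E; subst s; rewrite phase_time_at by easy.
    rewrite sin_PI_x, Rtrigo_facts.cos_pi_minus; split; [easy|].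
    assert (0 < sqrt (-2 * D) * cos theta); [|lra].
    apply Rmult_lt_0_compat; [easy | apply cos_gt_0; lra].
Qed.

Lemma transverse_z_of_y (S : state -> Prop) :
  (forall p, S p -> st_y p <> 0) -> transverse_z S.
Proof. intros H p Hp; specialize (H p Hp); cbn [vfield st_z]; lra. Qed.

Lemma half_ellipse_section_k_drop (D G c lam sm K theta : R) :
  0 < lam ->
  st_k (half_ellipse D G c lam sm K (time_at lam sm theta))
  - st_k (half_ellipse D G c lam sm K (time_at lam sm (PI - theta)))
  = -2 * D / lam ^ 3 * (PI - 2 * theta + sin (2 * theta)).
Proof.
  intro Hl; cbn [half_ellipse st_k]; rewrite !phase_time_at by easy.
  rewrite sin_PI_x, Rtrigo_facts.cos_pi_minus, sin_2a; field; lra.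
Qed.

Lemma asin_scaled_continuous_0 (b : R) : continuous (fun eta => asin (b * eta)) 0.
Proof.
  apply (continuous_comp (fun eta => b * eta) asin).
  - apply (ex_derive_continuous (fun eta => b * eta)); auto_derive; easy.
  - rewrite Rmult_0_r; apply continuity_pt_filterlim.
    apply derivable_continuous_pt, derivable_pt_asin; lra.
Qed.

(** The closed form of the drop is continuous in the angle, so the limit is its
    value at angle [0]. *)
Lemma half_ellipse_section_k_limit (D G c lam sm K b : R) :
  0 < lam ->
  filterlim
    (fun eta => st_k (half_ellipse D G c lam sm K (time_at lam sm (asin (b * eta))))
        - st_k (half_ellipse D G c lam sm K (time_at lam sm (PI - asin (b * eta)))))
    (at_right 0)
    (locally (st_k (half_ellipse D G c lam sm K sm)
              - st_k (half_ellipse D G c lam sm K (sm + 2 * PI / lam)))).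
Proof.
  intro Hl.
  rewrite half_ellipse_k_drop by easy.
  apply (filterlim_ext (fun eta => -2 * D / lam ^ 3
           * (PI - 2 * asin (b * eta) + sin (2 * asin (b * eta))))).
  { intro eta; symmetry; apply half_ellipse_section_k_drop, Hl. }
  apply filterlim_filter_le_1 with (1 := filter_le_at_right 0).
  replace (-2 * PI * D / lam ^ 3) with
    ((fun x => -2 * D / lam ^ 3 * (PI - 2 * x + sin (2 * x))) (asin (b * 0))).
  - apply (continuous_comp (fun eta => asin (b * eta))
      (fun x => -2 * D / lam ^ 3 * (PI - 2 * x + sin (2 * x))) 0).
    + apply asin_scaled_continuous_0.
    + apply (ex_derive_continuous
        (fun x => -2 * D / lam ^ 3 * (PI - 2 * x + sin (2 * x)))).
      auto_derive; easy.
  - rewrite Rmult_0_r, asin_0, Rmult_0_r, sin_0; field; lra.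
Qed.

(** * The jump of W *)

(** [w2] and [w3] are affine in [k] with slopes [xi] and [vdelta], and their
    constant terms are conserved quantities, which cancel in the difference. *)
Lemma W_jump (c vdelta : R) (p q : state) :
  st_D p = st_D q -> st_G p = st_G q -> st_xi p = c -> st_xi q = c ->
  minus (W vdelta q) (W vdelta p) = scal (st_k q - st_k p) (1, c, vdelta).
Proof.
  intros ED EG Ep Eq; unfold W; rewrite ED, EG, Ep, Eq.
  apply injective_projections; [apply injective_projections|].
  - change (st_k q + - st_k p = (st_k q - st_k p) * 1); ring.
  - change (c * st_k q - st_D q + - (c * st_k p - st_D q) = (st_k q - st_k p) * c); ring.
  - change (vdelta * st_k q - st_G q + - (vdelta * st_k p - st_G q)
            = (st_k q - st_k p) * vdelta); ring.
Qed.

(** * Matching the drop in k *)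

(** Uniqueness of limits: the end values of [k] are determined by the trajectory,
    whichever closed extension is taken. *)
Lemma closed_extension_ends (sm sp : R) (X Xb : R -> state) (p q : state) :
  closed_extension sm sp X Xb ->
  tends X (at_right sm) p -> tends X (at_left sp) q ->
  st_k (Xb sm) = st_k p /\ st_k (Xb sp) = st_k q.
Proof.
  intros (_ & (_ & _ & _ & H1 & _) & (_ & _ & _ & H2 & _))
    (_ & _ & _ & H3 & _) (_ & _ & _ & H4 & _).
  split; [eapply (filterlim_locally_unique _ _ _ H1 H3)
         | eapply (filterlim_locally_unique _ _ _ H2 H4)].
Qed.

Lemma Rpower_third_pow (x : R) : 0 < x -> Rpower x (1 / 3) ^ 3 = x.
Proof.
  intro Hx; rewrite <- Rpower_pow by apply exp_pos.
  rewrite Rpower_mult; replace (1 / 3 * INR 3) with 1 by (simpl; field).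
  apply Rpower_1, Hx.
Qed.

Lemma pow3_inj (x y : R) : 0 < x -> 0 < y -> x ^ 3 = y ^ 3 -> x = y.
Proof.
  intros Hx Hy E.
  assert (H : (x - y) * (x ^ 2 + x * y + y ^ 2) = 0) by (ring_simplify; lra).
  apply Rmult_integral in H; destruct H as [H|H]; [lra|].
  assert (0 < x * y) by (apply Rmult_lt_0_compat; easy).
  pose proof (pow2_ge_0 x); pose proof (pow2_ge_0 y); lra.
Qed.

Lemma matching_iff (A Delta lam : R) :
  0 < A -> 0 < Delta -> 0 < lam ->
  A / lam ^ 3 = Delta <-> lam = Rpower (A / Delta) (1 / 3).
Proof.
  intros HA HDl Hl.
  assert (HAD : 0 < A / Delta) by (apply Rdiv_lt_0_compat; easy).
  assert (Hl3 : lam ^ 3 <> 0) by (apply pow_nonzero; lra).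
  split; intro E.
  - apply pow3_inj; [easy | apply exp_pos |].
    rewrite Rpower_third_pow by easy; rewrite <- E; field; lra.
  - replace (lam ^ 3) with (A / Delta); [field; lra|].
    rewrite E at 1; symmetry; apply Rpower_third_pow, HAD.
Qed.


Theorem proposition3 (D G c vdelta : R) (HD : D < 0) :
  let a := sqrt (-2 * D) in
  0 < a /\
  (forall lam : R, 0 < lam ->
    (* existence, for every choice of the initial endpoint *)
    (forall sm : R, exists X : R -> state,
       special_trajectory D G c lam (Finite sm) (Finite (sm + 2 * PI / lam)) X) /\
    (* uniqueness of the (z,y,h)-components up to translation *)
    (forall (lo1 hi1 : Rbar) (X1 : R -> state) (lo2 hi2 : Rbar) (X2 : R -> state),
       special_trajectory D G c lam lo1 hi1 X1 ->
       special_trajectory D G c lam lo2 hi2 X2 ->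
       exists tau : R,
         lo2 = Rbar_plus lo1 (Finite tau) /\ hi2 = Rbar_plus hi1 (Finite tau) /\
         forall s : R, between lo1 hi1 s -> zyh (X2 (s + tau)) = zyh (X1 s)) /\
    (* properties of the trajectory *)
    (forall (lo hi : Rbar) (X : R -> state),
       special_trajectory D G c lam lo hi X ->
       exists (sm sp : R) (Xb : R -> state),
         lo = Finite sm /\ hi = Finite sp /\ sp = sm + 2 * PI / lam /\
         closed_extension sm sp X Xb /\
         zyh (Xb sm) = (0, a, G / D * a) /\
         zyh (Xb sp) = (0, - a, - (G / D) * a) /\
         (forall s : R, sm <= s <= sp ->
            zyh (Xb s) = (a / lam * sin (lam / 2 * (s - sm)),
                          a * cos (lam / 2 * (s - sm)),
                          G / D * a * cos (lam / 2 * (s - sm)))) /\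
         (exists s_in s_out : R -> R,
            (forall eta : R, 0 < eta < a / lam ->
               let theta := asin (lam * eta / a) in
               let r := sqrt (a ^ 2 - lam ^ 2 * eta ^ 2) in
               transverse_z (Sigma_in eta) /\ transverse_z (Sigma_out eta) /\
               0 < theta < PI / 2 /\
               sm < s_in eta < s_out eta /\ s_out eta < sp /\
               (forall s : R, sm <= s <= sp -> (Sigma_in eta (Xb s) <-> s = s_in eta)) /\
               (forall s : R, sm <= s <= sp -> (Sigma_out eta (Xb s) <-> s = s_out eta)) /\
               zyh (Xb (s_in eta)) = (eta, r, G / D * r) /\
               zyh (Xb (s_out eta)) = (eta, - r, - (G / D) * r) /\
               st_k (Xb (s_in eta)) - st_k (Xb (s_out eta))
                 = -2 * D / lam ^ 3 * (PI - 2 * theta + sin (2 * theta))) /\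
            filterlim (fun eta => st_k (Xb (s_in eta)) - st_k (Xb (s_out eta)))
              (at_right 0) (locally (st_k (Xb sm) - st_k (Xb sp)))) /\
         st_k (Xb sm) - st_k (Xb sp) = -2 * PI * D / lam ^ 3 /\
         minus (W vdelta (Xb sp)) (W vdelta (Xb sm))
           = scal (st_k (Xb sp) - st_k (Xb sm)) (1, c, vdelta))) /\
  (* matching of a prescribed change in k *)
  (forall Delta : R, 0 < Delta ->
    let lam_star := Rpower (-2 * PI * D / Delta) (1 / 3) in
    0 < lam_star /\
    (forall lam : R, 0 < lam ->
       ((exists (sm sp : R) (X Xb : R -> state),
           special_trajectory D G c lam (Finite sm) (Finite sp) X /\
           closed_extension sm sp X Xb /\
           st_k (Xb sm) - st_k (Xb sp) = Delta)
        <-> lam = lam_star)) /\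
    is_derive (fun lam => -2 * PI * D / lam ^ 3) lam_star (6 * PI * D / lam_star ^ 4) /\
    6 * PI * D / lam_star ^ 4 <> 0).

Proof.
  intro a.
  pose proof (amplitude_pos D HD) as Ha; fold a in Ha.
  pose proof PI_RGT_0 as HPI.
  split; [exact Ha | split].
  - intros lam Hl; split; [|split].
    + intro sm; exists (half_ellipse D G c lam sm 0).
      apply half_ellipse_special; easy.
    + intros lo1 hi1 X1 lo2 hi2 X2 H1 H2.
      apply special_trajectory_classification in H1; try easy.
      apply special_trajectory_classification in H2; try easy.
      destruct H1 as (sm1 & K1 & -> & -> & E1), H2 as (sm2 & K2 & -> & -> & E2).
      exists (sm2 - sm1); simpl; split; [f_equal; ring | split; [f_equal; ring |]].
      intros s Hs; simpl in Hs.
      rewrite E1, E2 by (unfold between in Hs; simpl in Hs; lra).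
      unfold zyh; cbn [half_ellipse st_z st_y st_h].
      replace (phase lam sm2 (s + (sm2 - sm1))) with (phase lam sm1 s)
        by (unfold phase; ring).
      easy.
    + intros lo hi X HX.
      apply special_trajectory_classification in HX; try easy.
      destruct HX as (sm & K & Elo & Ehi & E).
      exists sm, (sm + 2 * PI / lam), (half_ellipse D G c lam sm K).
      do 3 (split; [easy|]).
      split; [|split; [|split; [|split; [|split; [|split]]]]].
      * split; [intros s Hs; symmetry; apply E, Hs | split].
        -- apply half_ellipse_tends_start; easy.
        -- apply half_ellipse_tends_end; easy.
      * apply half_ellipse_zyh_start.
      * apply half_ellipse_zyh_end, Hl.
      * easy.
      * exists (fun eta => time_at lam sm (asin (lam * eta / a))),
          (fun eta => time_at lam sm (PI - asin (lam * eta / a))).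
        split.
        -- intros eta Heta theta r.
           destruct (section_angle a lam eta Ha Hl Heta) as (Ht & Ez & Ey).
           fold theta in Ht, Ez, Ey |- *; fold r in Ey.
           do 2 (split; [apply transverse_z_of_y; intros p [_ Hp]; lra|]).
           split; [exact Ht|].
           split.
           { split; [rewrite <- (time_at_0 lam sm) at 1|];
               apply time_at_lt; try easy; lra. }
           split.
           { apply (time_at_lt lam sm (PI - theta) PI); [easy | lra]. }
           split.
           { intros s Hs; rewrite <- Ez; apply Sigma_in_half_ellipse; easy. }
           split.
           { intros s Hs; rewrite <- Ez; apply Sigma_out_half_ellipse; easy. }
           split.
           { unfold zyh; cbn [half_ellipse st_z st_y st_h].
             rewrite phase_time_at by easy; fold a.
             rewrite Rmult_assoc, Ez, Ey; easy. }
           split.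
           { unfold zyh; cbn [half_ellipse st_z st_y st_h].
             rewrite phase_time_at, sin_PI_x, Rtrigo_facts.cos_pi_minus by easy.
             fold a; rewrite Ez, <- Ey; f_equal; [f_equal|]; ring. }
           apply half_ellipse_section_k_drop, Hl.
        -- eapply filterlim_ext;
             [|apply (half_ellipse_section_k_limit D G c lam sm K (lam / a) Hl)].
           intro eta; simpl.
           replace (lam / a * eta) with (lam * eta / a) by (field; lra); easy.
      * apply half_ellipse_k_drop, Hl.
      * apply W_jump; easy.
  - intros Delta HDel lam_star.
    assert (HA : 0 < -2 * PI * D) by nra.
    assert (Hs : 0 < lam_star) by apply exp_pos.
    split; [exact Hs | split; [|split]].
    + intros lam Hl; unfold lam_star; rewrite <- matching_iff by easy; split.
      * intros (sm & sp & X & Xb & HX & HXb & <-).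
        apply special_trajectory_classification in HX; try easy.
        destruct HX as (sm' & K & E1 & E2 & E).
        injection E1 as <-; injection E2 as ->.
        destruct (closed_extension_ends _ _ X Xb _ _ HXb
          (half_ellipse_tends_start D G c lam sm K X Hl E)
          (half_ellipse_tends_end D G c lam sm K X Hl E)) as [-> ->].
        symmetry; apply half_ellipse_k_drop, Hl.
      * intro E; exists 0, (0 + 2 * PI / lam), (half_ellipse D G c lam 0 0),
          (half_ellipse D G c lam 0 0).
        split; [apply half_ellipse_special; easy | split; [split; [easy | split] |]].
        -- apply half_ellipse_tends_start; easy.
        -- apply half_ellipse_tends_end; easy.
        -- rewrite half_ellipse_k_drop; easy.
    + assert (lam_star ^ 3 <> 0) by (apply pow_nonzero; lra).
      auto_derive; [simpl in *; easy | field; lra].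
    + apply Rlt_not_eq, Rdiv_neg_pos; [nra | apply pow_lt, Hs].
Qed.
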